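(* The theory $\mathrm{ZF}^*-\mathrm{Ext}$ (that is, $\mathrm{ZF}^*$ with the axiom of Extensionality removed) interprets $\mathrm{ZF}$: there is a relative interpretation of $\mathrm{ZF}$ (standard Zermelo–Fraenkel set theory, with full Extensionality, Foundation and Replacement) in $\mathrm{ZF}^*-\mathrm{Ext}$, where the equality of $\mathrm{ZF}$ may be interpreted by a formula other than identity, the membership relation of $\mathrm{ZF}$ by a formula, and the quantifiers may be restricted to a definable domain.
   Context: The language is first-order logic with equality and one binary relation symbol $\in$. $\mathrm{ZF}^*$ is the theory with the axioms: - Extensionality: $\forall X\,\forall Y\,(\forall z(z\in X\leftrightarrow z\in Y)\rightarrow X=Y)$. - Foundation: $\forall A\,[\exists X(X\in A)\rightarrow \exists Y\in A\,(\neg\exists Z\in A\,(Z\in Y))]$. - Pairing: $\forall A\,\forall B\,\exists X\,\forall Y(Y\in X\leftrightarrow Y=A\lor Y=B)$. - Union: $\forall A\,\exists X\,\forall Y(Y\in X\leftrightarrow\exists Z\in A\,(Y\in Z))$. - Power: $\forall A\,\exists X\,\forall Y(Y\in X\leftrightarrow\forall Z\in Y\,(Z\in A))$. - Infinity: $\exists N\,(\emptyset\in N\wedge\forall n\in N\,\exists m\in N\,\forall y(y\in m\leftrightarrow y\in n\lor y=n))$, where $\emptyset\in N$ means that $N$ has an element that has no elements. - Replacement* (schema): for each formula $\phi(X,Z)$ in which only the symbols $X,Z$ occur free, and those occur only free, $\forall A\,\exists B\,\forall Y\,[Y\in B\leftrightarrow\exists X\in A\,\forall Z(Z\in Y\leftrightarrow\phi(X,Z))]$.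 $\mathrm{ZF}^*-\mathrm{Ext}$ is the theory with all of these axioms except Extensionality. *)

(* Defs.v *)
From Stdlib Require Import List.

(** First-order logic with equality over one binary relation symbol.  The
    language has no function symbols, so terms are variables, i.e. de Bruijn
    indices, and substitutions are maps [nat -> nat]. *)
Inductive form : Type :=
| Mem : nat -> nat -> form
| Eq : nat -> nat -> form
| Bot : form
| Imp : form -> form -> form
| All : form -> form.

Definition Not (p : form) : form := Imp p Bot.
Definition And (p q : form) : form := Not (Imp p (Not q)).
Definition Or (p q : form) : form := Imp (Not p) q.
Definition Iff (p q : form) : form := And (Imp p q) (Imp q p).
Definition Ex (p : form) : form := Not (All (Not p)).

Declare Scope fo_scope.
Delimit Scope fo_scope with fo.
Bind Scope fo_scope with form.
Notation "x ∈ y" := (Mem x y) (at level 70, no associativity) : fo_scope.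
Notation "x ≐ y" := (Eq x y) (at level 70, no associativity) : fo_scope.
Notation "¬ p" := (Not p) (at level 75, right associativity) : fo_scope.
Notation "p ∧ q" := (And p q) (at level 80, right associativity) : fo_scope.
Notation "p ∨ q" := (Or p q) (at level 85, right associativity) : fo_scope.
Notation "p ⟶ q" := (Imp p q) (at level 90, right associativity) : fo_scope.
Notation "p ⟷ q" := (Iff p q) (at level 95, no associativity) : fo_scope.

(** [∀ x ∈ a, p] and [∃ x ∈ a, p]: the index [a] is read outside the
    quantifier; inside [p] the bound variable is [0]. *)
Definition AllIn (a : nat) (p : form) : form := All (0 ∈ S a ⟶ p)%fo.
Definition ExIn (a : nat) (p : form) : form := Ex (0 ∈ S a ∧ p)%fo.

Definition scons (x : nat) (r : nat -> nat) (i : nat) : nat :=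
  match i with 0 => x | S j => r j end.

Definition up (r : nat -> nat) : nat -> nat := scons 0 (fun i => S (r i)).

Fixpoint ren (r : nat -> nat) (p : form) : form :=
  match p with
  | Mem x y => Mem (r x) (r y)
  | Eq x y => Eq (r x) (r y)
  | Bot => Bot
  | Imp p q => Imp (ren r p) (ren r q)
  | All p => All (ren (up r) p)
  end.

Definition inst (p : form) (x : nat) : form := ren (scons x (fun i => i)) p.

(** All free variables of [p] are [< n]. *)
Fixpoint bounded (n : nat) (p : form) : Prop :=
  match p with
  | Mem x y | Eq x y => x < n /\ y < n
  | Bot => True
  | Imp p q => bounded n p /\ bounded n q
  | All p => bounded (S n) p
  end.

Definition sentence (p : form) : Prop := bounded 0 p.

(** Classical natural deduction. *)
Inductive prv : list form -> form -> Prop :=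
| prv_hyp G p : In p G -> prv G p
| prv_impI G p q : prv (p :: G) q -> prv G (Imp p q)
| prv_impE G p q : prv G (Imp p q) -> prv G p -> prv G q
| prv_raa G p : prv (Not p :: G) Bot -> prv G p
| prv_allI G p : prv (map (ren S) G) p -> prv G (All p)
| prv_allE G p x : prv G (All p) -> prv G (inst p x)
| prv_eq_refl G x : prv G (Eq x x)
| prv_eq_subst G p x y : prv G (Eq x y) -> prv G (inst p x) -> prv G (inst p y).

Definition theory : Type := form -> Prop.

Definition proves (T : theory) (p : form) : Prop :=
  exists G : list form, (forall q, In q G -> T q) /\ prv G p.

(** The data of a (one-dimensional, parameter-free) relative interpretation:
    a domain formula with free variable [0], and formulas with free variables
    [0], [1] reading [0 ∈ 1] and [0 = 1]. *)
Record translation : Type := Translation {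
  t_dom : form;
  t_mem : form;
  t_eq : form;
  t_dom_bounded : bounded 1 t_dom;
  t_mem_bounded : bounded 2 t_mem;
  t_eq_bounded : bounded 2 t_eq
}.

Definition inst2 (p : form) (x y : nat) : form :=
  ren (scons x (scons y (fun i => i))) p.

(** [Ex] abbreviates [¬ ∀ ¬], so relativizing [All] also relativizes [Ex]. *)
Fixpoint translate (t : translation) (p : form) : form :=
  match p with
  | Mem x y => inst2 (t_mem t) x y
  | Eq x y => inst2 (t_eq t) x y
  | Bot => Bot
  | Imp p q => Imp (translate t p) (translate t q)
  | All p => All (Imp (t_dom t) (translate t p))
  end.

(** [T] interprets [U].  The quantification is over all theorems of [U], not
    only its axioms, so [T] must also prove the translations of the laws of
    equality and of the nonemptiness of the domain. *)
Definition interprets (T U : theory) : Prop :=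
  exists t : translation,
    forall p, sentence p -> proves U p -> proves T (translate t p).

(** [∀X ∀Y (∀z (z ∈ X ↔ z ∈ Y) → X = Y)] *)
Definition ax_extensionality : form :=
  All (All (All (0 ∈ 2 ⟷ 0 ∈ 1) ⟶ 1 ≐ 0)).

(** [∀A (∃X (X ∈ A) → ∃Y ∈ A ¬ ∃Z ∈ A (Z ∈ Y))] *)
Definition ax_foundation : form :=
  All (Ex (0 ∈ 1) ⟶ ExIn 0 (¬ ExIn 1 (0 ∈ 1))).

(** [∀A ∀B ∃X ∀Y (Y ∈ X ↔ Y = A ∨ Y = B)] *)
Definition ax_pairing : form :=
  All (All (Ex (All (0 ∈ 1 ⟷ 0 ≐ 3 ∨ 0 ≐ 2)))).

(** [∀A ∃X ∀Y (Y ∈ X ↔ ∃Z ∈ A (Y ∈ Z))] *)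
Definition ax_union : form :=
  All (Ex (All (0 ∈ 1 ⟷ ExIn 2 (1 ∈ 0)))).

(** [∀A ∃X ∀Y (Y ∈ X ↔ ∀Z ∈ Y (Z ∈ A))] *)
Definition ax_power : form :=
  All (Ex (All (0 ∈ 1 ⟷ AllIn 0 (0 ∈ 3)))).

(** [∃N (∃e ∈ N ∀y ¬ (y ∈ e) ∧ ∀n ∈ N ∃m ∈ N ∀y (y ∈ m ↔ y ∈ n ∨ y = n))] *)
Definition ax_infinity : form :=
  Ex (ExIn 0 (All (¬ 0 ∈ 1)) ∧
      AllIn 0 (ExIn 1 (All (0 ∈ 1 ⟷ 0 ∈ 2 ∨ 0 ≐ 2)))).

(** [∀A ∃B ∀Y (Y ∈ B ↔ ∃X ∈ A ∀Z (Z ∈ Y ↔ φ(X,Z)))], where [φ] has [Z] as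
    variable [0] and [X] as variable [1], and no other free variables. *)
Definition ax_replacement_star (phi : form) : form :=
  All (Ex (All (0 ∈ 1 ⟷ ExIn 2 (All (0 ∈ 2 ⟷ phi))))).

(** [φ(x,y)], with [y] as variable [0], [x] as variable [1] and parameters
    from [2] on, placed under four binders above the parameters. *)
Definition at_xy (phi : form) (x y : nat) : form :=
  ren (scons y (scons x (fun i => 4 + i))) phi.

(** [∀A (∀x ∈ A ∀y ∀y' (φ(x,y) ∧ φ(x,y') → y = y') →
         ∃B ∀y (y ∈ B ↔ ∃x ∈ A φ(x,y)))],
    with the parameters of [φ] left free.  As [φ] need not be total on [A],
    this schema contains Separation. *)
Definition replacement (phi : form) : form :=
  All (AllIn 0 (All (All (at_xy phi 2 1 ∧ at_xy phi 2 0 ⟶ 1 ≐ 0))) ⟶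
       Ex (All (0 ∈ 1 ⟷ ExIn 2 (at_xy phi 0 1)))).

Fixpoint alls (n : nat) (p : form) : form :=
  match n with 0 => p | S n => All (alls n p) end.

Inductive ZFstar_minus_Ext : theory :=
| ZFs_foundation : ZFstar_minus_Ext ax_foundation
| ZFs_pairing : ZFstar_minus_Ext ax_pairing
| ZFs_union : ZFstar_minus_Ext ax_union
| ZFs_power : ZFstar_minus_Ext ax_power
| ZFs_infinity : ZFstar_minus_Ext ax_infinity
| ZFs_replacement_star phi :
    bounded 2 phi -> ZFstar_minus_Ext (ax_replacement_star phi).

Inductive ZF : theory :=
| ZF_extensionality : ZF ax_extensionality
| ZF_foundation : ZF ax_foundation
| ZF_pairing : ZF ax_pairing
| ZF_union : ZF ax_union
| ZF_power : ZF ax_power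
| ZF_infinity : ZF ax_infinity
| ZF_replacement n phi :
    bounded (2 + n) phi -> ZF (alls n (replacement phi)).

(* Main.v *)
From Stdlib Require Import List Arith Lia Classical ClassicalEpsilon.
From Stdlib Require Import Cantor.
Require Import Defs.

(** By completeness it suffices to build, inside every model of ZF* - Ext, a model of ZF
    whose domain, membership and equality are defined by fixed formulas.  Call a set
    saturated if it contains every coextensional copy of each of its elements, and keep the
    hereditarily saturated sets.  On these, coextensionality is a congruence for membership,
    so it can serve as equality and Extensionality holds.

    Replacement* applied to [fun z => forall y, F x y -> z ∈ y] is the image of a set
    under a parameter-free definable function, closed under copies; this yields
    Separation, the hereditarily saturated hull of a set and parameter-free Replacement.
    Parameters are then coded, one at a time, into the elements of the set to which
    Replacement is applied.  The set given by Infinity is not saturated, but the finite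
    levels of the cumulative hierarchy are canonical up to copies, so collecting the
    levels of its members gives a saturated set closed under successor. *)

(** * Completeness of first-order logic *)

Lemma up_ext r s : (forall i, r i = s i) -> forall i, up r i = up s i.
Proof. intros H [|i]; simpl; [|rewrite H]; reflexivity. Qed.

Lemma ren_bounded_ext p : forall n r s, bounded n p ->
  (forall i, i < n -> r i = s i) -> ren r p = ren s p.
Proof.
  induction p as [x y|x y| |p IHp q IHq|p IHp]; simpl; intros n r s Hb Hrs.
  - rewrite !Hrs by tauto; reflexivity.
  - rewrite !Hrs by tauto; reflexivity.
  - reflexivity.
  - f_equal; [eapply IHp | eapply IHq]; intuition eauto.
  - f_equal; apply (IHp (S n)); [assumption|].
    intros [|i] Hi; simpl; [reflexivity|]. rewrite Hrs by lia; reflexivity.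
Qed.

Lemma ren_ext p : forall r s, (forall i, r i = s i) -> ren r p = ren s p.
Proof.
  induction p as [x y|x y| |p IHp q IHq|p IHp]; simpl; intros r s H; rewrite ?H; try reflexivity.
  - f_equal; auto.
  - f_equal; auto using up_ext.
Qed.

Lemma ren_ren p : forall r s, ren s (ren r p) = ren (fun i => s (r i)) p.
Proof.
  induction p as [x y|x y| |p IHp q IHq|p IHp]; simpl; intros r s; try reflexivity.
  - f_equal; auto.
  - f_equal. rewrite IHp. apply ren_ext. intros [|i]; reflexivity.
Qed.

Lemma ren_id p : forall r, (forall i, r i = i) -> ren r p = p.
Proof.
  induction p as [x y|x y| |p IHp q IHq|p IHp]; simpl; intros r H; rewrite ?H; try reflexivity.
  - f_equal; auto.
  - f_equal; apply IHp. intros [|i]; simpl; auto.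
Qed.

Lemma bounded_mono p : forall n m, n <= m -> bounded n p -> bounded m p.
Proof.
  induction p as [x y|x y| |p IHp q IHq|p IHp]; simpl; intros n m Hnm; try (intuition lia).
  - intuition eauto.
  - apply IHp; lia.
Qed.

Lemma bounded_ren p : forall n m r, bounded n p ->
  (forall i, i < n -> r i < m) -> bounded m (ren r p).
Proof.
  induction p as [x y|x y| |p IHp q IHq|p IHp]; simpl;
    intros n m r Hb Hr; try (intuition auto; fail).
  - intuition eauto.
  - apply (IHp (S n)); [assumption|].
    intros [|i] Hi; simpl; [lia|]. specialize (Hr i); lia.
Qed.

Lemma bounded_exists p : exists n, bounded n p.
Proof.
  induction p as [x y|x y| |p [n Hn] q [m Hm]|p [n Hn]]; simpl.
  - exists (S (x + y)); lia.
  - exists (S (x + y)); lia.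
  - exists 0; exact I.
  - exists (n + m); split; eapply bounded_mono; try eassumption; lia.
  - exists n; eapply bounded_mono; try eassumption; lia.
Qed.

Lemma bounded_exists_list G : exists n, forall p, In p G -> bounded n p.
Proof.
  induction G as [|p G [n Hn]]; [exists 0; intros ? []|].
  destruct (bounded_exists p) as [m Hm]. exists (n + m).
  intros q [<-|Hq]; [apply (bounded_mono p m) | apply (bounded_mono q n)]; auto; lia.
Qed.

Lemma prv_weaken G p : prv G p -> forall G', incl G G' -> prv G' p.
Proof.
  induction 1 as [G p HG|G p q _ IH|G p q _ IH1 _ IH2|G p _ IH|G p _ IH|G p x _ IH
                 |G x|G p x y _ IH1 _ IH2]; intros G' HGG'.
  - apply prv_hyp; auto.
  - apply prv_impI, IH. intros a [<-|Ha]; simpl; auto.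
  - eapply prv_impE; eauto.
  - apply prv_raa, IH. intros a [<-|Ha]; simpl; auto.
  - apply prv_allI, IH. apply incl_map; assumption.
  - apply prv_allE; auto.
  - apply prv_eq_refl.
  - eapply prv_eq_subst; eauto.
Qed.

Lemma ren_inst r p x : ren r (inst p x) = inst (ren (up r) p) (r x).
Proof.
  unfold inst. rewrite !ren_ren. apply ren_ext. intros [|i]; reflexivity.
Qed.

Lemma prv_ren G p : prv G p -> forall r, prv (map (ren r) G) (ren r p).
Proof.
  induction 1 as [G p HG|G p q _ IH|G p q _ IH1 _ IH2|G p _ IH|G p _ IH|G p x _ IH
                 |G x|G p x y _ IH1 _ IH2]; intros r; simpl.
  - apply prv_hyp, in_map; assumption.
  - apply prv_impI, (IH r).
  - exact (prv_impE _ _ _ (IH1 r) (IH2 r)).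
  - apply prv_raa, (IH r).
  - apply prv_allI. specialize (IH (up r)).
    rewrite map_map in *. erewrite map_ext; [exact IH|].
    intros a; cbv beta. rewrite !ren_ren. apply ren_ext. reflexivity.
  - rewrite ren_inst. apply prv_allE, (IH r).
  - apply prv_eq_refl.
  - rewrite ren_inst in *. apply (prv_eq_subst _ _ (r x)); [apply (IH1 r)|].
    rewrite <- ren_inst. apply IH2.
Qed.

(** The renaming [r] sends [c] to 0 and shifts every index below [c]. On formulas bounded by [c] it
    acts as [S], and it undoes the instantiation of [p] at [c], so a derivation with the
    eigenvariable [c] becomes the premise of [prv_allI]. *)
Lemma prv_allI_fresh G p c :
  (forall q, In q G -> bounded c q) -> bounded (S c) p ->
  prv G (inst p c) -> prv G (All p).
Proof.
  intros HG Hp H. apply prv_allI.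
  pose (r := fun i => if Nat.eq_dec i c then 0 else S i).
  assert (Hr : forall i, i < c -> r i = S i).
  { intros i Hi. unfold r. destruct (Nat.eq_dec i c); [lia|reflexivity]. }
  apply (prv_ren _ _) with (r := r) in H.
  replace (ren r (inst p c)) with p in H.
  - erewrite map_ext_in; [exact H|].
    intros q Hq. apply (ren_bounded_ext q c); [auto|].
    intros i Hi. symmetry; auto.
  - unfold inst. rewrite ren_ren. rewrite <- (ren_id p (fun i => i)) at 1 by reflexivity.
    apply (ren_bounded_ext p (S c)); [assumption|].
    intros [|i] Hi; simpl.
    + unfold r. destruct (Nat.eq_dec c c); congruence.
    + rewrite Hr by lia; reflexivity.
Qed.

(** [equ] is only a congruence: the term model is then not quotiented, and the model of ZF
    can take coextensionality as its equality. *)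
Record model : Type := Model {
  carrier :> Type;
  mem : carrier -> carrier -> Prop;
  equ : carrier -> carrier -> Prop;
  equ_refl : forall x, equ x x;
  equ_sym : forall x y, equ x y -> equ y x;
  equ_trans : forall x y z, equ x y -> equ y z -> equ x z;
  mem_equ : forall x x' y y', equ x x' -> equ y y' -> mem x y -> mem x' y'
}.
Arguments mem {m} _ _.
Arguments equ {m} _ _.

Definition cons_env {A : Type} (x : A) (r : nat -> A) (i : nat) : A :=
  match i with 0 => x | S j => r j end.

Fixpoint sat (M : model) (r : nat -> M) (p : form) : Prop :=
  match p with
  | Mem x y => mem (r x) (r y)
  | Eq x y => equ (r x) (r y)
  | Bot => False
  | Imp p q => sat M r p -> sat M r q
  | All p => forall x, sat M (cons_env x r) p
  end.

(** The congruence property of [equ] propagates through all connectives. This validates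
    [prv_eq_subst] in models that are not quotiented, and later allows a set to be exchanged for a
    copy inside a formula. *)
Lemma sat_equ (M : model) p : forall n (r s : nat -> M), bounded n p ->
  (forall i, i < n -> equ (r i) (s i)) -> sat M r p <-> sat M s p.
Proof.
  induction p as [x y|x y| |p IHp q IHq|p IHp]; simpl; intros n r s Hb H.
  - destruct Hb as [Hx Hy]. pose proof (H _ Hx). pose proof (H _ Hy).
    split; apply mem_equ; auto using equ_sym.
  - destruct Hb as [Hx Hy]. pose proof (H _ Hx). pose proof (H _ Hy).
    split; intros; eauto using equ_trans, equ_sym.
  - tauto.
  - rewrite (IHp n r s), (IHq n r s); tauto.
  - assert (E : forall x, sat M (cons_env x r) p <-> sat M (cons_env x s) p).
    { intros x. apply (IHp (S n)); [assumption|].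
      intros [|i] Hi; simpl; [apply equ_refl | apply H; lia]. }
    split; intros K x; apply E, K.
Qed.

Lemma sat_bounded (M : model) p n (r s : nat -> M) : bounded n p ->
  (forall i, i < n -> r i = s i) -> sat M r p <-> sat M s p.
Proof.
  intros Hb H. apply (sat_equ M p n); [assumption|].
  intros i Hi. rewrite H by assumption. apply equ_refl.
Qed.

Lemma sat_ext (M : model) p (r s : nat -> M) :
  (forall i, r i = s i) -> sat M r p <-> sat M s p.
Proof.
  intros H. destruct (bounded_exists p) as [n Hn].
  apply (sat_bounded M p n); auto.
Qed.

Lemma sat_ren (M : model) p : forall s (r : nat -> M),
  sat M r (ren s p) <-> sat M (fun i => r (s i)) p.
Proof.
  induction p as [x y|x y| |p IHp q IHq|p IHp]; simpl; intros s r; try tauto.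
  - rewrite IHp, IHq; tauto.
  - assert (E : forall x, sat M (cons_env x r) (ren (up s) p) <->
                          sat M (cons_env x (fun i => r (s i))) p).
    { intros x. rewrite IHp. apply sat_ext. intros [|i]; reflexivity. }
    split; intros K x; apply E, K.
Qed.

Lemma sat_inst (M : model) p x (r : nat -> M) :
  sat M r (inst p x) <-> sat M (cons_env (r x) r) p.
Proof.
  unfold inst. rewrite sat_ren. apply sat_ext. intros [|i]; reflexivity.
Qed.

Lemma soundness G p : prv G p ->
  forall (M : model) (r : nat -> M), (forall q, In q G -> sat M r q) -> sat M r p.
Proof.
  induction 1 as [G p HG|G p q _ IH|G p q _ IH1 _ IH2|G p _ IH|G p _ IH|G p x _ IH
                 |G x|G p x y _ IH1 _ IH2]; intros M r HGr; simpl.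
  - auto.
  - intros Hp. apply IH. intros a [<-|Ha]; auto.
  - apply (IH1 M r HGr), (IH2 M r HGr).
  - apply NNPP. intros Hp. apply (IH M r). intros a [<-|Ha]; auto.
  - intros x. apply IH. intros q Hq. apply in_map_iff in Hq as [q' [<- Hq']].
    apply sat_ren, HGr, Hq'.
  - apply sat_inst, (IH M r HGr).
  - apply equ_refl.
  - specialize (IH1 M r HGr). specialize (IH2 M r HGr). simpl in IH1.
    rewrite sat_inst in *. destruct (bounded_exists p) as [n Hn].
    refine (proj1 (sat_equ M p n _ _ Hn _) IH2).
    intros [|i] _; simpl; auto using equ_refl.
Qed.

(** * Enumeration of formulas *)

Fixpoint code (p : form) : nat :=
  match p with
  | Mem x y => to_nat (0, to_nat (x, y))
  | Eq x y => to_nat (1, to_nat (x, y))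
  | Bot => to_nat (2, 0)
  | Imp p q => to_nat (3, to_nat (code p, code q))
  | All p => to_nat (4, code p)
  end.

Lemma to_nat_inj a b : to_nat a = to_nat b -> a = b.
Proof. intros H. rewrite <- (cancel_of_to a), H. apply cancel_of_to. Qed.

Lemma code_inj p : forall q, code p = code q -> p = q.
Proof.
  induction p as [x y|x y| |p IHp q IHq|p IHp]; intros [ ]; cbn [code]; intros H;
    apply to_nat_inj in H; try discriminate (f_equal fst H);
    apply (f_equal snd) in H; cbn [snd] in H.
  - apply to_nat_inj in H. congruence.
  - apply to_nat_inj in H. congruence.
  - reflexivity.
  - apply to_nat_inj in H. injection H as H1 H2. f_equal; auto.
  - f_equal; auto.
Qed.

(** A number that codes nothing decodes to an arbitrary formula. This is harmless, since a Henkin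
    stage may treat any formula. *)
Definition decode (n : nat) : form := epsilon (inhabits Bot) (fun p => code p = n).

Lemma decode_code p : decode (code p) = p.
Proof.
  apply code_inj. unfold decode.
  apply (epsilon_spec (inhabits Bot) (fun q => code q = code p)). exists p; reflexivity.
Qed.

(** * Henkin construction and term model *)

Section Completeness.

Variable T : theory.
Hypothesis T_closed : forall q, T q -> bounded 0 q.

(** The axioms used are kept apart from [L]. Being closed they do not affect the choice of an
    eigenvariable, so a variable fresh for the finite list [L] suffices. *)
Definition derives (L : list form) (p : form) : Prop :=
  exists G, (forall q, In q G -> T q) /\ prv (L ++ G) p.

Definition consistent (L : list form) : Prop := ~ derives L Bot.

Lemma derives_weaken L L' p : incl L L' -> derives L p -> derives L' p.
Proof.
  intros HL [G [HG H]]. exists G; split; [assumption|].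
  apply (prv_weaken _ _ H). apply incl_app; [apply incl_appl | apply incl_appr, incl_refl].
  assumption.
Qed.

Lemma derives_hyp L p : In p L -> derives L p.
Proof. intros H. exists nil; split; [intros ? []|]. apply prv_hyp, in_or_app; auto. Qed.

Lemma derives_axiom L p : T p -> derives L p.
Proof.
  intros H. exists (p :: nil); split; [intros q [<-|[]]; assumption|].
  apply prv_hyp, in_or_app; simpl; auto.
Qed.

Lemma derives_impI L p q : derives (p :: L) q -> derives L (Imp p q).
Proof. intros [G [HG H]]. exists G; split; [assumption|]. apply prv_impI; exact H. Qed.

Lemma derives_raa L p : derives (Not p :: L) Bot -> derives L p.
Proof. intros [G [HG H]]. exists G; split; [assumption|]. apply prv_raa; exact H. Qed.

Lemma prv_app_incl_r L G G' p : prv (L ++ G) p -> incl G G' -> prv (L ++ G') p.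
Proof.
  intros H HG. apply (prv_weaken _ _ H). apply incl_app; [apply incl_appl, incl_refl|].
  apply incl_appr; assumption.
Qed.

Lemma derives_impE L p q : derives L (Imp p q) -> derives L p -> derives L q.
Proof.
  intros [G [HG H]] [G' [HG' H']]. exists (G ++ G'); split.
  - intros a Ha. apply in_app_or in Ha as []; auto.
  - apply (prv_impE _ p).
    + apply (prv_app_incl_r _ _ _ _ H), incl_appl, incl_refl.
    + apply (prv_app_incl_r _ _ _ _ H'), incl_appr, incl_refl.
Qed.

Lemma derives_allE L p x : derives L (All p) -> derives L (inst p x).
Proof. intros [G [HG H]]. exists G; split; [assumption|]. apply prv_allE; exact H. Qed.

Lemma derives_allI_fresh L p c :
  (forall q, In q L -> bounded c q) -> bounded (S c) p ->
  derives L (inst p c) -> derives L (All p).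
Proof.
  intros HL Hp [G [HG H]]. exists G; split; [assumption|].
  apply (prv_allI_fresh _ _ c); auto.
  intros q Hq. apply in_app_or in Hq as [Hq|Hq]; [auto|].
  apply (bounded_mono q 0); [lia|]. auto.
Qed.

(* As [T] is closed, every variable is a Henkin constant for it. *)
Definition fresh (L : list form) : nat :=
  epsilon (inhabits 0) (fun n => forall p, In p L -> bounded n p).

Lemma fresh_spec L p : In p L -> bounded (fresh L) p.
Proof.
  revert p. apply (epsilon_spec (inhabits 0) (fun n => forall p, In p L -> bounded n p)).
  apply bounded_exists_list.
Qed.

(** A rejected universal formula receives a named counterexample in the same step, so maximality and
    the Henkin property are obtained by one recursion. *)
Definition witness (L : list form) (p : form) : list form :=
  match p with
  | All q => Not (inst q (fresh (p :: L))) :: Not p :: L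
  | _ => Not p :: L
  end.

Definition extend (L : list form) (p : form) : list form :=
  if excluded_middle_informative (consistent (p :: L)) then p :: L else witness L p.

Lemma incl_witness L p : incl (Not p :: L) (witness L p).
Proof. destruct p; simpl; try apply incl_refl. apply incl_tl, incl_refl. Qed.

(** If [p] is inconsistent with [L], then [L] derives [Not p], which can be added safely. If the
    counterexample at the fresh variable were then refutable, generalizing over that variable would
    give the universal formula just rejected. *)
Lemma consistent_extend L p : consistent L -> consistent (extend L p).
Proof.
  intros HL. unfold extend. destruct (excluded_middle_informative _) as [H|H]; [exact H|].
  apply NNPP in H.
  assert (Hn : derives L (Not p)) by (apply derives_impI, H).
  assert (HN : consistent (Not p :: L)).
  { intros K. apply HL. apply (derives_impE _ (Not p)); [apply derives_impI, K | exact Hn]. }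
  destruct p as [ | | | |p]; simpl; auto.
  intros K. apply HN. apply (derives_impE _ (All p)); [apply derives_hyp; simpl; auto|].
  apply (derives_allI_fresh _ _ (fresh (All p :: L))).
  - intros q [<-|Hq]; simpl.
    + split; [|exact I]. apply (fresh_spec (All p :: L) (All p)); simpl; auto.
    + apply fresh_spec; simpl; auto.
  - apply (fresh_spec (All p :: L) (All p)); simpl; auto.
  - apply derives_raa, K.
Qed.

Fixpoint stage (L : list form) (n : nat) : list form :=
  match n with 0 => L | S n => extend (stage L n) (decode n) end.

Variable L0 : list form.
Hypothesis L0_consistent : consistent L0.

Lemma incl_stage n m : n <= m -> incl (stage L0 n) (stage L0 m).
Proof.
  induction 1 as [|m _ IH]; [apply incl_refl|].
  apply (incl_tran IH). simpl. unfold extend.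
  destruct (excluded_middle_informative _); [apply incl_tl, incl_refl|].
  eapply incl_tran; [|apply incl_witness]. apply incl_tl, incl_refl.
Qed.

Lemma consistent_stage n : consistent (stage L0 n).
Proof. induction n; simpl; [assumption|]. apply consistent_extend; assumption. Qed.

(** The deductive closure of the union of the stages, which will be a maximal consistent theory with
    witnesses. *)
Definition henkin (p : form) : Prop := exists n, derives (stage L0 n) p.

Lemma henkin_impE p q : henkin (Imp p q) -> henkin p -> henkin q.
Proof.
  intros [n Hn] [m Hm]. exists (n + m). apply (derives_impE _ p).
  - apply (derives_weaken (stage L0 n)); [apply incl_stage; lia | assumption].
  - apply (derives_weaken (stage L0 m)); [apply incl_stage; lia | assumption].
Qed.

Lemma henkin_consistent : ~ henkin Bot.
Proof. intros [n Hn]. exact (consistent_stage n Hn). Qed.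

(** The formula [p] is decided at the step numbered [code p]. Had it been accepted there, it would
    belong to [henkin]; hence the other branch was taken and left [Not p] with its
    counterexample. *)
Lemma henkin_complete p : ~ henkin p ->
  henkin (Not p) /\
  match p with All q => exists c, henkin (Not (inst q c)) | _ => True end.
Proof.
  intros Hp.
  assert (E : stage L0 (S (code p)) = witness (stage L0 (code p)) p).
  { simpl. rewrite decode_code. unfold extend.
    destruct (excluded_middle_informative _) as [H|H]; [|reflexivity].
    exfalso. apply Hp. exists (S (code p)). simpl. rewrite decode_code. unfold extend.
    destruct (excluded_middle_informative _); [|tauto]. apply derives_hyp; simpl; auto. }
  assert (K : forall q, In q (witness (stage L0 (code p)) p) -> henkin q).
  { intros q Hq. exists (S (code p)). rewrite E. apply derives_hyp; assumption. }
  split.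
  - apply K, incl_witness; simpl; auto.
  - destruct p; auto. eexists; apply K; simpl; eauto.
Qed.

Lemma henkin_imp p q : henkin (Imp p q) <-> (henkin p -> henkin q).
Proof.
  split; [apply henkin_impE|]. intros H.
  destruct (classic (henkin p)) as [Hp|Hp].
  - destruct (H Hp) as [n Hn]. exists n. apply derives_impI.
    apply (derives_weaken (stage L0 n)); [apply incl_tl, incl_refl | assumption].
  - destruct (henkin_complete p Hp) as [[n Hn] _]. exists n. apply derives_impI.
    apply derives_raa. apply (derives_impE _ p); [|apply derives_hyp; simpl; auto].
    apply (derives_weaken (stage L0 n)); [do 2 apply incl_tl; apply incl_refl | assumption].
Qed.

Lemma henkin_all p : henkin (All p) <-> forall x, henkin (inst p x).
Proof.
  split.
  - intros [n Hn] x. exists n. apply derives_allE, Hn.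
  - intros H. apply NNPP. intros K. apply henkin_complete in K as [_ [c Hc]].
    apply henkin_consistent, (henkin_impE _ _ Hc), H.
Qed.

Lemma henkin_eq_refl x : henkin (Eq x x).
Proof. exists 0, nil. split; [intros ? []|]. apply prv_eq_refl. Qed.

Lemma henkin_eq_subst p x y : henkin (Eq x y) -> henkin (inst p x) -> henkin (inst p y).
Proof.
  intros HE HP. apply (henkin_impE (inst p x)); [|assumption].
  destruct HE as [n [G [HG HE]]]. exists n, G; split; [assumption|].
  apply prv_impI, (prv_eq_subst _ _ x); [|apply prv_hyp; simpl; auto].
  apply (prv_weaken _ _ HE), incl_tl, incl_refl.
Qed.

Lemma henkin_eq_sym x y : henkin (Eq x y) -> henkin (Eq y x).
Proof.
  intros H. apply (henkin_eq_subst (Eq 0 (S x)) x y H), henkin_eq_refl.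
Qed.

Lemma henkin_eq_trans x y z : henkin (Eq x y) -> henkin (Eq y z) -> henkin (Eq x z).
Proof. intros H K. apply (henkin_eq_subst (Eq (S x) 0) y z K), H. Qed.

Lemma henkin_mem_eq x x' y y' :
  henkin (Eq x x') -> henkin (Eq y y') -> henkin (Mem x y) -> henkin (Mem x' y').
Proof.
  intros Hx Hy H. apply (henkin_eq_subst (Mem (S x') 0) y y' Hy).
  apply (henkin_eq_subst (Mem 0 (S y)) x x' Hx), H.
Qed.

Definition term_model : model :=
  Model nat (fun x y => henkin (Mem x y)) (fun x y => henkin (Eq x y))
    henkin_eq_refl henkin_eq_sym henkin_eq_trans henkin_mem_eq.

(** The carrier consists of the variables, so an environment is also a renaming. Keeping [r] general
    turns the quantifier case into [henkin_all]. *)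
Lemma truth p : forall r : nat -> nat, sat term_model r p <-> henkin (ren r p).
Proof.
  induction p as [x y|x y| |p IHp q IHq|p IHp]; simpl; intros r; try tauto.
  - split; [tauto | apply henkin_consistent].
  - rewrite IHp, IHq, henkin_imp; tauto.
  - rewrite henkin_all.
    assert (E : forall x, henkin (inst (ren (up r) p) x) <->
                          sat term_model (cons_env x r) p).
    { intros x. rewrite IHp. unfold inst. rewrite ren_ren.
      erewrite ren_ext; [reflexivity|]. intros [|i]; reflexivity. }
    split; intros K x; apply E, K.
Qed.

End Completeness.

(** If [T] does not prove [p], then [Not p] is consistent with [T], and the term model over it, with
    the identity as environment, satisfies [T] and refutes [p]. *)
Theorem completeness (T : theory) p :
  (forall q, T q -> bounded 0 q) ->
  (forall (M : model) (r : nat -> M), (forall q, T q -> sat M r q) -> sat M r p) ->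
  proves T p.
Proof.
  intros HT H. apply NNPP. intros Hp.
  assert (HC : consistent T (Not p :: nil)).
  { intros [G [HG K]]. apply Hp. exists G; split; [assumption|]. apply prv_raa, K. }
  assert (E : forall q, henkin T (Not p :: nil) q ->
              sat (term_model T (Not p :: nil)) (fun i => i) q).
  { intros q Hq. apply truth; [exact HT | exact HC |]. rewrite ren_id; auto. }
  assert (N : sat (term_model T (Not p :: nil)) (fun i => i) (Not p)).
  { apply E. exists 0. apply derives_hyp; simpl; auto. }
  apply N, H. intros q Hq. apply E. exists 0. apply derives_axiom, Hq.
Qed.

(** * Hereditarily saturated sets *)

Declare Scope model_scope.
Notation "x ∈ y" := (mem x y) (at level 70, no associativity) : model_scope.

Section Satisfaction.

Variable M : model.
Implicit Types (r : nat -> M) (p q : form).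

Lemma sat_not r p (P : Prop) : (sat M r p <-> P) -> (sat M r (Not p) <-> ~ P).
Proof. simpl. tauto. Qed.

Lemma sat_imp r p q (P Q : Prop) : (sat M r p <-> P) -> (sat M r q <-> Q) ->
  (sat M r (Imp p q) <-> (P -> Q)).
Proof. simpl. tauto. Qed.

Lemma sat_and r p q (P Q : Prop) : (sat M r p <-> P) -> (sat M r q <-> Q) ->
  (sat M r (And p q) <-> P /\ Q).
Proof. simpl. tauto. Qed.

Lemma sat_or r p q (P Q : Prop) : (sat M r p <-> P) -> (sat M r q <-> Q) ->
  (sat M r (Or p q) <-> P \/ Q).
Proof. simpl. tauto. Qed.

Lemma sat_iff r p q (P Q : Prop) : (sat M r p <-> P) -> (sat M r q <-> Q) ->
  (sat M r (Iff p q) <-> (P <-> Q)).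
Proof. simpl. tauto. Qed.

Lemma sat_all r p (P : M -> Prop) : (forall x, sat M (cons_env x r) p <-> P x) ->
  (sat M r (All p) <-> forall x, P x).
Proof. intros H. split; intros K x; apply H, K. Qed.

Lemma sat_ex r p (P : M -> Prop) : (forall x, sat M (cons_env x r) p <-> P x) ->
  (sat M r (Ex p) <-> exists x, P x).
Proof.
  intros H. simpl. split.
  - intros K. apply NNPP. intros N. apply K. intros x Hx. apply N. exists x. apply H, Hx.
  - intros [x Hx] K. exact (K x (proj2 (H x) Hx)).
Qed.

Lemma sat_allIn r a p (P : M -> Prop) : (forall x, sat M (cons_env x r) p <-> P x) ->
  (sat M r (AllIn a p) <-> forall x, mem x (r a) -> P x).
Proof. intros H. apply sat_all. intros x. apply sat_imp; [reflexivity | apply H]. Qed.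

Lemma sat_exIn r a p (P : M -> Prop) : (forall x, sat M (cons_env x r) p <-> P x) ->
  (sat M r (ExIn a p) <-> exists x, mem x (r a) /\ P x).
Proof. intros H. apply sat_ex. intros x. apply sat_and; [reflexivity | apply H]. Qed.

Definition ext_eq (u v : M) : Prop := forall z, mem z u <-> mem z v.
Definition sub (u v : M) : Prop := forall z, mem z u -> mem z v.

Definition copies_in (v u : M) : Prop := forall w, ext_eq w v -> mem w u.

Definition saturated (u : M) : Prop :=
  forall v, mem v u -> copies_in v u.

Definition good (u : M) : Prop :=
  forall v, mem v u ->
    sub v u /\ saturated v /\ copies_in v u.

Definition hered (u : M) : Prop := exists L, good L /\ mem u L.

(** For [u] hereditarily saturated, the sets below [u] form the least good class containing [u]: its
    transitive closure, with [u] and all copies included. [hull] says that this class is a set. *)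
Definition below (z u : M) : Prop := forall L, good L -> mem u L -> mem z L.
Definition hull (u g : M) : Prop := forall z, mem z g <-> below z u.

Definition empty (u : M) : Prop := forall z, ~ mem z u.
Definition is_power (u v : M) : Prop := forall z, mem z v <-> sub z u.

(** The elements of a tower are the finite levels of the cumulative hierarchy. *)
Definition tower (t : M) : Prop :=
  forall v, mem v t ->
    (forall u, mem u v -> sub u v) /\
    (empty v \/ exists w, mem w t /\ is_power w v).

Definition level (v : M) : Prop := exists t, tower t /\ mem v t.
(** Being a subset but not an element of a level of the cumulative hierarchy pins down the level
    indexed by the rank of [n], with no mention of ordinals. *)
Definition level_of (n v : M) : Prop := level v /\ sub n v /\ ~ mem n v.

End Satisfaction.
Arguments ext_eq {M} u v.
Arguments sub {M} u v.
Arguments copies_in {M} v u.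
Arguments saturated {M} u.
Arguments good {M} u.
Arguments hered {M} u.
Arguments below {M} z u.
Arguments hull {M} u g.
Arguments empty {M} u.
Arguments is_power {M} u v.
Arguments tower {M} t.
Arguments level {M} v.
Arguments level_of {M} n v.

Create HintDb sat.

(** Both sides of the equivalence are decomposed in parallel, one connective at a time. Defined
    formulas are left folded and closed by the [sat] hints. *)
Ltac sat_step := lazymatch goal with
  | |- forall _, _ => intro
  | |- sat _ _ (Not _) <-> _ => apply sat_not
  | |- sat _ _ (Imp _ _) <-> _ => apply sat_imp
  | |- sat _ _ (And _ _) <-> _ => apply sat_and
  | |- sat _ _ (Or _ _) <-> _ => apply sat_or
  | |- sat _ _ (Iff _ _) <-> _ => apply sat_iff
  | |- sat _ _ (All _) <-> _ => apply sat_all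
  | |- sat _ _ (Ex _) <-> _ => apply sat_ex
  | |- sat _ _ (AllIn _ _) <-> _ => refine (sat_allIn _ _ _ _ _ _)
  | |- sat _ _ (ExIn _ _) <-> _ => refine (sat_exIn _ _ _ _ _ _)
  | |- sat _ _ (Mem _ _) <-> _ => reflexivity
  | |- sat _ _ (Eq _ _) <-> _ => reflexivity
  | |- sat _ _ Bot <-> _ => reflexivity
  | |- sat _ _ (ren _ _) <-> _ => etransitivity; [apply sat_ren|]
  end.

Ltac sat_tac := repeat sat_step; auto with sat.

(** In this and the following formulas the arguments are indices read outside the formula, hence one
    [S] for each quantifier crossed. *)
Definition fSub x y := All (0 ∈ S x ⟶ 0 ∈ S y)%fo.
Definition fEqv x y := All (0 ∈ S x ⟷ 0 ∈ S y)%fo.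
Definition fCopiesIn x y := All (fEqv 0 (S x) ⟶ 0 ∈ S y)%fo.
Definition fSaturated x := AllIn x (fCopiesIn 0 (S x)).
Definition fGood x := AllIn x (fSub 0 (S x) ∧ fSaturated 0 ∧ fCopiesIn 0 (S x))%fo.
Definition fHered x := Ex (fGood 0 ∧ S x ∈ 0)%fo.
Definition fBelow z u := All (fGood 0 ⟶ S u ∈ 0 ⟶ S z ∈ 0)%fo.
Definition fHull u g := All (0 ∈ S g ⟷ fBelow 0 (S u))%fo.
Definition fEmpty x := All (¬ 0 ∈ S x)%fo.
Definition fPower u v := All (0 ∈ S v ⟷ fSub 0 (S u))%fo.
Definition fTower t :=
  AllIn t (AllIn 0 (fSub 0 1) ∧ (fEmpty 0 ∨ ExIn (S t) (fPower 0 1)))%fo.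
Definition fLevel v := Ex (fTower 0 ∧ S v ∈ 0)%fo.
Definition fLevelOf n v := (fLevel v ∧ fSub n v ∧ ¬ n ∈ v)%fo.

Lemma sat_fSub (M : model) (r : nat -> M) x y : sat M r (fSub x y) <-> sub (r x) (r y).
Proof. unfold fSub, sub. sat_tac. Qed.
#[export] Hint Extern 0 (sat _ _ (fSub _ _) <-> _) => exact (sat_fSub _ _ _ _) : sat.

Lemma sat_fEqv (M : model) (r : nat -> M) x y : sat M r (fEqv x y) <-> ext_eq (r x) (r y).
Proof. unfold fEqv, ext_eq. sat_tac. Qed.
#[export] Hint Extern 0 (sat _ _ (fEqv _ _) <-> _) => exact (sat_fEqv _ _ _ _) : sat.

Lemma sat_fCopiesIn (M : model) (r : nat -> M) x y :
  sat M r (fCopiesIn x y) <-> copies_in (r x) (r y).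
Proof. unfold fCopiesIn, copies_in. sat_tac. Qed.
#[export] Hint Extern 0 (sat _ _ (fCopiesIn _ _) <-> _) => exact (sat_fCopiesIn _ _ _ _) : sat.

Lemma sat_fSaturated (M : model) (r : nat -> M) x : sat M r (fSaturated x) <-> saturated (r x).
Proof. unfold fSaturated, saturated. sat_tac. Qed.
#[export] Hint Extern 0 (sat _ _ (fSaturated _) <-> _) => exact (sat_fSaturated _ _ _) : sat.

Lemma sat_fGood (M : model) (r : nat -> M) x : sat M r (fGood x) <-> good (r x).
Proof. unfold fGood, good. sat_tac. Qed.
#[export] Hint Extern 0 (sat _ _ (fGood _) <-> _) => exact (sat_fGood _ _ _) : sat.

Lemma sat_fHered (M : model) (r : nat -> M) x : sat M r (fHered x) <-> hered (r x).
Proof. unfold fHered, hered. sat_tac. Qed.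
#[export] Hint Extern 0 (sat _ _ (fHered _) <-> _) => exact (sat_fHered _ _ _) : sat.

Lemma sat_fBelow (M : model) (r : nat -> M) x y : sat M r (fBelow x y) <-> below (r x) (r y).
Proof. unfold fBelow, below. sat_tac. Qed.
#[export] Hint Extern 0 (sat _ _ (fBelow _ _) <-> _) => exact (sat_fBelow _ _ _ _) : sat.

Lemma sat_fHull (M : model) (r : nat -> M) x y : sat M r (fHull x y) <-> hull (r x) (r y).
Proof. unfold fHull, hull. sat_tac. Qed.
#[export] Hint Extern 0 (sat _ _ (fHull _ _) <-> _) => exact (sat_fHull _ _ _ _) : sat.

Lemma sat_fEmpty (M : model) (r : nat -> M) x : sat M r (fEmpty x) <-> empty (r x).
Proof. unfold fEmpty, empty. sat_tac. Qed.
#[export] Hint Extern 0 (sat _ _ (fEmpty _) <-> _) => exact (sat_fEmpty _ _ _) : sat.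

Lemma sat_fPower (M : model) (r : nat -> M) x y : sat M r (fPower x y) <-> is_power (r x) (r y).
Proof. unfold fPower, is_power. sat_tac. Qed.
#[export] Hint Extern 0 (sat _ _ (fPower _ _) <-> _) => exact (sat_fPower _ _ _ _) : sat.

Lemma sat_fTower (M : model) (r : nat -> M) x : sat M r (fTower x) <-> tower (r x).
Proof. unfold fTower, tower. sat_tac. Qed.
#[export] Hint Extern 0 (sat _ _ (fTower _) <-> _) => exact (sat_fTower _ _ _) : sat.

Lemma sat_fLevel (M : model) (r : nat -> M) x : sat M r (fLevel x) <-> level (r x).
Proof. unfold fLevel, level. sat_tac. Qed.
#[export] Hint Extern 0 (sat _ _ (fLevel _) <-> _) => exact (sat_fLevel _ _ _) : sat.

Lemma sat_fLevelOf (M : model) (r : nat -> M) x y : sat M r (fLevelOf x y) <-> level_of (r x) (r y).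
Proof. unfold fLevelOf, level_of. sat_tac. Qed.
#[export] Hint Extern 0 (sat _ _ (fLevelOf _ _) <-> _) => exact (sat_fLevelOf _ _ _ _) : sat.

(** * The inner model and its translation *)

Section HereditarilySaturated.

Variable M : model.

Lemma ext_eq_refl (u : M) : ext_eq u u.
Proof. intros z; reflexivity. Qed.

Lemma ext_eq_sym (u v : M) : ext_eq u v -> ext_eq v u.
Proof. intros H z; symmetry; apply H. Qed.

Lemma ext_eq_trans (u v w : M) : ext_eq u v -> ext_eq v w -> ext_eq u w.
Proof. intros H K z; rewrite (H z); apply K. Qed.

Lemma hered_mem_ext_eq (x x' y y' : M) :
  hered y -> ext_eq x x' -> ext_eq y y' -> mem x y -> mem x' y'.
Proof.
  intros [L [HL Hy]] Hx Hyy H. apply Hyy.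
  destruct (HL y Hy) as (_ & Hs & _). apply (Hs x H), ext_eq_sym, Hx.
Qed.

Lemma hered_mem (x y : M) : hered y -> mem x y -> hered x.
Proof. intros [L [HL Hy]] H. exists L. split; [assumption|]. exact (proj1 (HL y Hy) x H). Qed.

Lemma hered_ext_eq (x y : M) : hered y -> ext_eq x y -> hered x.
Proof.
  intros [L [HL Hy]] H. exists L. split; [assumption|].
  exact (proj2 (proj2 (HL y Hy)) x H).
Qed.

Lemma hered_saturated (x : M) : hered x -> saturated x.
Proof. intros [L [HL Hx]]. apply (HL x Hx). Qed.

Definition hered_model : model.
Proof.
  refine (Model {x : M | hered x} (fun x y => mem (proj1_sig x) (proj1_sig y))
    (fun x y => ext_eq (proj1_sig x) (proj1_sig y)) _ _ _ _).
  - intros; apply ext_eq_refl.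
  - intros x y; apply ext_eq_sym.
  - intros x y z; apply ext_eq_trans.
  - intros x x' [y Hy] y' Hx Hyy. exact (hered_mem_ext_eq _ _ _ _ Hy Hx Hyy).
Defined.

End HereditarilySaturated.

Definition hered_translation : translation.
Proof.
  refine (Translation (fHered 0) (Mem 0 1) (fEqv 0 1) _ _ _); simpl; repeat split; lia.
Defined.

Lemma sat_translate (M : model) p : forall r : nat -> hered_model M,
  sat (hered_model M) r p <->
  sat M (fun i => proj1_sig (r i)) (translate hered_translation p).
Proof.
  induction p as [x y|x y| |p IHp q IHq|p IHp]; intros r; cbn [translate].
  - reflexivity.
  - cbn [t_eq hered_translation]. unfold inst2. rewrite sat_ren, sat_fEqv. reflexivity.
  - reflexivity.
  - apply sat_imp; [apply IHp | apply IHq].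
  - cbn [t_dom hered_translation].
    assert (E : forall x : hered_model M, sat (hered_model M) (cons_env x r) p <->
      sat M (cons_env (proj1_sig x) (fun i => proj1_sig (r i))) (translate hered_translation p)).
    { intros x. rewrite IHp. apply sat_ext. intros [|i]; reflexivity. }
    split.
    + intros H x Hx. apply sat_fHered in Hx. apply (E (exist _ x Hx)), H.
    + intros H [x Hx]. apply E, H, sat_fHered, Hx.
Qed.

Lemma bounded_translate t p : forall n, bounded n p -> bounded n (translate t p).
Proof.
  induction p as [x y|x y| |p IHp q IHq|p IHp]; simpl; intros n H; try (intuition; fail).
  - apply (bounded_ren _ 2); [apply t_mem_bounded|].
    intros [|[|i]] Hi; simpl; lia.
  - apply (bounded_ren _ 2); [apply t_eq_bounded|].
    intros [|[|i]] Hi; simpl; lia.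
  - split; [|auto]. apply (bounded_mono _ 1); [lia | apply t_dom_bounded].
Qed.

(** * Set existence without Extensionality *)

Section SetTheory.

Variable M : model.
Variable r0 : nat -> M.
Hypothesis M_sat : forall q, ZFstar_minus_Ext q -> sat M r0 q.

Local Open Scope model_scope.

Lemma axiom_holds q (P : Prop) : ZFstar_minus_Ext q -> (sat M r0 q <-> P) -> P.
Proof. intros Hq H. apply H, M_sat, Hq. Qed.

Lemma foundation (A : M) : (exists x, x ∈ A) ->
  exists y, y ∈ A /\ ~ exists z, z ∈ A /\ z ∈ y.
Proof.
  revert A. apply (axiom_holds _ _ ZFs_foundation). unfold ax_foundation. sat_tac.
Qed.

Lemma pairing (A B : M) : exists X, forall y, y ∈ X <-> equ y A \/ equ y B.
Proof.
  revert A B. apply (axiom_holds _ _ ZFs_pairing). unfold ax_pairing. sat_tac.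
Qed.

Lemma union (A : M) : exists X, forall y, y ∈ X <-> exists z, z ∈ A /\ y ∈ z.
Proof.
  revert A. apply (axiom_holds _ _ ZFs_union). unfold ax_union. sat_tac.
Qed.

Lemma power (A : M) : exists X, is_power A X.
Proof.
  revert A. apply (axiom_holds _ _ ZFs_power). unfold ax_power, is_power, sub. sat_tac.
Qed.

Lemma infinity : exists N : M, (exists e, e ∈ N /\ empty e) /\
  forall n, n ∈ N -> exists m, m ∈ N /\ forall y, y ∈ m <-> y ∈ n \/ equ y n.
Proof.
  apply (axiom_holds _ _ ZFs_infinity). unfold ax_infinity, empty. sat_tac.
Qed.

Definition definable1 (P : M -> Prop) : Prop :=
  exists phi, bounded 1 phi /\ forall r, sat M r phi <-> P (r 0).

Definition definable2 (R : M -> M -> Prop) : Prop :=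
  exists phi, bounded 2 phi /\ forall r, sat M r phi <-> R (r 1) (r 0).

Lemma replacement_star (R : M -> M -> Prop) : definable2 R ->
  forall A, exists B, forall y, y ∈ B <-> exists x, x ∈ A /\ forall z, z ∈ y <-> R x z.
Proof.
  intros (phi & Hb & Hphi).
  apply (axiom_holds _ _ (ZFs_replacement_star phi Hb)).
  unfold ax_replacement_star. sat_tac.
Qed.

Lemma copy_of_equ (x y : M) : equ x y -> ext_eq x y.
Proof.
  intros H z. split; apply mem_equ; auto using equ_refl, equ_sym.
Qed.

Lemma not_mem_self (x : M) : ~ x ∈ x.
Proof.
  intros H. destruct (pairing x x) as [A HA].
  destruct (foundation A) as [y [Hy K]].
  { exists x. apply HA. left. apply equ_refl. }
  apply K. exists y. split; [assumption|]. assert (E : equ y x) by (apply HA in Hy; tauto).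
  apply (mem_equ _ x y x y); auto using equ_sym.
Qed.

(* Where [F x] is undefined, [fun z => forall y, F x y -> z ∈ y] is the universal class, so
   Replacement* puts nothing in the image for such [x]. *)
Lemma replacement_definable (F : M -> M -> Prop) (A : M) : definable2 F ->
  (forall x, x ∈ A -> forall y y', F x y -> F x y' -> ext_eq y y') ->
  exists B, forall y, y ∈ B <-> exists x, x ∈ A /\ exists y', F x y' /\ ext_eq y y'.
Proof.
  intros (phi & Hb & Hphi) HF.
  destruct (replacement_star (fun x z => forall y, F x y -> z ∈ y)) with (A := A) as [B HB].
  (* Under the quantifier, 0 is the value [y], 1 is the candidate element [z] and 2 is the argument
     [x]. *)
  - exists (All (ren (scons 0 (scons 2 (fun i => i))) phi ⟶ 1 ∈ 0)%fo). split.
    + split; [|simpl; lia]. apply (bounded_ren _ 2); [assumption|].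
      intros [|[|i]] Hi; simpl; lia.
    + intros r. sat_tac.
  - exists B. intros y. rewrite HB. split; intros [x [Hx K]]; exists x; (split; [assumption|]).
    + destruct (classic (exists y', F x y')) as [[y' Hy']|N].
      * exists y'. split; [assumption|]. intros z. rewrite K. split; [auto|].
        intros Hz y'' Hy''. apply (HF x Hx y' y''); assumption.
      * exfalso. apply (not_mem_self y), K. intros y' Hy'. destruct N. exists y'; assumption.
    + destruct K as [y' [Hy' E]]. intros z. rewrite (E z). split; [|auto].
      intros Hz y'' Hy''. apply (HF x Hx y' y''); assumption.
Qed.

(** This is the image of [A] under the identity restricted to [P]. Since images are closed under
    copies, the result may contain copies that lie outside [A]. *)
Lemma separation (P : M -> Prop) (A : M) : definable1 P ->
  exists B, forall y, y ∈ B <-> exists x, x ∈ A /\ P x /\ ext_eq y x.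
Proof.
  intros (phi & Hb & Hphi).
  destruct (replacement_definable (fun x y => P x /\ ext_eq y x) A) as [B HB].
  - exists (ren (fun _ => 1) phi ∧ fEqv 0 1)%fo. split.
    + split; [|simpl; repeat split; lia].
      split; [apply (bounded_ren _ 1); [assumption|intros; lia] | simpl; repeat split; lia].
    + intros r. sat_tac.
  - intros x _ y y' [_ Hy] [_ Hy']. eapply ext_eq_trans; [exact Hy|].
    apply ext_eq_sym, Hy'.
  - exists B. intros y. rewrite HB. split; intros [x [Hx K]]; exists x; (split; [assumption|]).
    + destruct K as [y' [[HP Hy'] E]]. split; [assumption|]. eapply ext_eq_trans; eassumption.
    + exists x. repeat split; try apply K; auto.
Qed.

(** Pairing yields only sets [equ] to [x]; Separation by a trivial condition then closes the result
    under copies. *)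
Lemma copies (x : M) : exists B, forall y, y ∈ B <-> ext_eq y x.
Proof.
  destruct (pairing x x) as [A HA].
  destruct (separation (fun _ => True) A) as [B HB].
  { exists (Bot ⟶ Bot)%fo. simpl. tauto. }
  exists B. intros y. rewrite HB. split.
  - intros [x' (Hx & _ & E)]. apply (ext_eq_trans _ _ _ _ E), copy_of_equ.
    apply HA in Hx. tauto.
  - intros E. exists x. split; [|tauto]. apply HA. left. apply equ_refl.
Qed.

Lemma union2 (A B : M) : exists C, forall y, y ∈ C <-> y ∈ A \/ y ∈ B.
Proof.
  destruct (pairing A B) as [P HP]. destruct (union P) as [C HC].
  exists C. intros y. rewrite HC. split.
  - intros [z [Hz Hy]]. apply HP in Hz as [E|E]; apply copy_of_equ in E; [left|right];
      apply E, Hy.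
  - intros [H|H]; [exists A|exists B]; (split; [|assumption]); apply HP;
      [left|right]; apply equ_refl.
Qed.

(** Foundation is applied to the separated set [B]. The minimal element found is only a copy of some
    element of [A] satisfying [P], but that element has the same members and so is minimal too. The
    lemma serves as induction on membership. *)
Lemma minimal_element (P : M -> Prop) (A : M) : definable1 P ->
  (exists x, x ∈ A /\ P x) ->
  exists x, x ∈ A /\ P x /\ forall y, y ∈ x -> y ∈ A -> ~ P y.
Proof.
  intros HP [x [Hx HPx]]. destruct (separation P A HP) as [B HB].
  destruct (foundation B) as [y [Hy K]].
  { exists x. apply HB. exists x. auto using ext_eq_refl. }
  apply HB in Hy as [x' (Hx' & HPx' & E)]. exists x'. repeat (split; [assumption|]).
  intros z Hz HzA HPz. apply K. exists z. split; [|apply E, Hz].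
  apply HB. exists z. auto using ext_eq_refl.
Qed.

(** * Hulls and the introduction rule for hereditary saturation *)

Lemma saturated_ext_eq (u v : M) : ext_eq u v -> saturated v -> saturated u.
Proof. intros E H x Hx w Hw. apply E, (H x); [apply E, Hx | exact Hw]. Qed.

Lemma below_refl (u : M) : below u u.
Proof. intros L _ H; exact H. Qed.

Lemma below_trans (u v w : M) : below u v -> below v w -> below u w.
Proof. intros H K L HL Hw. apply (H L HL), (K L HL), Hw. Qed.

Lemma below_mem (u v : M) : u ∈ v -> below u v.
Proof. intros H L HL Hv. exact (proj1 (HL v Hv) u H). Qed.

Lemma below_ext_eq (u v : M) : ext_eq u v -> below u v.
Proof. intros H L HL Hv. exact (proj2 (proj2 (HL v Hv)) u H). Qed.

Lemma hered_below (u v : M) : hered v -> below u v -> hered u.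
Proof. intros [L [HL Hv]] H. exists L. auto. Qed.

Lemma definable2_hull : definable2 hull.
Proof. exists (fHull 1 0). split; [simpl; repeat split; lia|]. intros r; sat_tac. Qed.

(** [K] is the union of the hulls of the members of [u] together with all copies of [u]. Hulls are
    unique up to copies, so Replacement can collect them, whereas arbitrary good sets around the
    members could not be chosen. *)
Lemma good_hull_of_hulls (u : M) : saturated u ->
  (forall w, w ∈ u -> hered w /\ exists g, hull w g) ->
  exists K, good K /\ forall z, z ∈ K <-> (exists w, w ∈ u /\ below z w) \/ ext_eq z u.
Proof.
  intros Hu H.
  destruct (replacement_definable hull u definable2_hull) as [B HB].
  { intros w _ g g' Hg Hg' z. rewrite (Hg z), (Hg' z). reflexivity. }
  destruct (union B) as [D HD]. destruct (copies u) as [C HC].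
  destruct (union2 D C) as [K HK].
  assert (E : forall z, z ∈ K <-> (exists w, w ∈ u /\ below z w) \/ ext_eq z u).
  { intros z. rewrite HK, HC, HD. split; (intros [K1|K1]; [left|right; exact K1]).
    - destruct K1 as [g [Hg Hz]]. apply HB in Hg as [w [Hw [g' [Hg' Eg]]]].
      exists w. split; [assumption|]. apply Hg', Eg, Hz.
    - destruct K1 as [w [Hw Hz]]. destruct (H w Hw) as [_ [g Hg]]. exists g.
      split; [|apply Hg, Hz]. apply HB. exists w. split; [assumption|].
      exists g. auto using ext_eq_refl. }
  exists K. split; [|exact E].
  intros v Hv. apply E in Hv as [[w [Hw Hv]]|Hv]; repeat split.
  - intros z Hz. apply E. left. exists w. split; [assumption|].
    apply (below_trans _ v); [apply below_mem, Hz | exact Hv].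
  - apply hered_saturated, (hered_below v w); [apply (H w Hw) | exact Hv].
  - intros z Hz. apply E. left. exists w. split; [assumption|].
    apply (below_trans _ v); [apply below_ext_eq, Hz | exact Hv].
  - intros z Hz. apply E. left. exists z. split; [apply Hv, Hz | apply below_refl].
  - apply (saturated_ext_eq _ u); assumption.
  - intros z Hz. apply E. right. apply (ext_eq_trans _ _ v); assumption.
Qed.

(** In a good set around [v], take a minimal [u] without a hull. Its members lie in the same good
    set and have hulls, so [K] exists; being good and containing [u], it contains everything below
    [u], and is therefore its hull. *)
Lemma hull_exists (v : M) : hered v -> exists g, hull v g.
Proof.
  intros [L [HL Hv]]. apply NNPP. intros N.
  destruct (minimal_element (fun v => ~ exists g, hull v g) L) as [u (Hu & Nu & Hmin)].
  - exists (¬ Ex (fHull 1 0))%fo. split; [simpl; repeat split; lia|]. intros r. sat_tac.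
  - exists v. auto.
  - apply Nu. destruct (good_hull_of_hulls u) as [K [HK E]].
    + apply (HL u Hu).
    + intros w Hw. assert (HwL : w ∈ L) by exact (proj1 (HL u Hu) w Hw). split.
      * exists L. auto.
      * apply NNPP. exact (Hmin w Hw HwL).
    + exists K. intros z. rewrite E. split.
      * intros [[w [Hw Hz]]|Hz]; [|apply below_ext_eq, Hz].
        apply (below_trans _ w); [exact Hz | apply below_mem, Hw].
      * intros Hz. apply E, (Hz K HK), E. right. apply ext_eq_refl.
Qed.

Lemma hered_intro (u : M) : saturated u -> (forall w, w ∈ u -> hered w) -> hered u.
Proof.
  intros Hu H. destruct (good_hull_of_hulls u Hu) as [K [HK E]].
  - auto using hull_exists.
  - exists K. split; [exact HK|]. apply E. right. apply ext_eq_refl.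
Qed.

(** * Finite levels of the cumulative hierarchy *)

Lemma level_sub_closed (v z y : M) : level v -> z ∈ v -> sub y z -> y ∈ v.
Proof.
  intros [t [Ht Hv]] Hz Hy. destruct (Ht v Hv) as [_ [He|[w [_ Hw]]]].
  - destruct (He z Hz).
  - apply Hw. intros x Hx. apply Hw in Hz. apply Hz, Hy, Hx.
Qed.

Lemma level_trans (v z : M) : level v -> z ∈ v -> sub z v.
Proof. intros [t [Ht Hv]] Hz. exact (proj1 (Ht v Hv) z Hz). Qed.

(** Take a minimal counterexample [u] in a tower. The cases of an empty level are immediate;
    otherwise [u] and the other level are power sets of [w] and [w']. Minimality compares [w] with
    [w']: inclusion passes to the power sets, and [w' ∈ w] makes every subset of [w'] an element of
    [w]. *)
Lemma level_compare (v v' : M) : level v -> level v' -> sub v v' \/ v' ∈ v.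
Proof.
  intros [t [Ht Hv]] Hv'. apply NNPP. intros N.
  destruct (minimal_element
    (fun v => exists v', level v' /\ ~ sub v v' /\ ~ v' ∈ v) t) as [u (Hu & Nu & Hmin)].
  - exists (Ex (fLevel 0 ∧ ¬ fSub 1 0 ∧ ¬ 0 ∈ 1))%fo.
    split; [simpl; repeat split; lia|]. intros r. sat_tac.
  - exists v. split; [assumption|]. exists v'. tauto.
  - clear v v' Hv Hv' N. destruct Nu as (v & Hv & N1 & N2).
    destruct (Ht u Hu) as [_ [He|[w [Hw Pw]]]].
    { apply N1. intros z Hz. destruct (He z Hz). }
    assert (Cw : forall v', level v' -> sub w v' \/ v' ∈ w).
    { intros v' Hv'. apply NNPP. intros N. apply (Hmin w); [|assumption|].
      - apply Pw. intros z Hz; exact Hz.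
      - exists v'. tauto. }
    destruct Hv as [t' [Ht' Hv]]. destruct (Ht' v Hv) as [_ [He|[w' [Hw' Pw']]]].
    { apply N2, Pw. intros z Hz. destruct (He z Hz). }
    destruct (Cw w') as [S|S].
    + exists t'; auto.
    + apply N1. intros z Hz. apply Pw'. intros y Hy. apply S. apply Pw in Hz. apply Hz, Hy.
    + apply N2, Pw. intros z Hz. apply (level_sub_closed w w'); [exists t; auto|assumption|].
      apply Pw', Hz.
Qed.

Lemma level_empty (e : M) : empty e -> level e.
Proof.
  intros He. destruct (pairing e e) as [t Ht]. exists t. split.
  - intros v Hv. assert (E : ext_eq v e) by (apply copy_of_equ; apply Ht in Hv; tauto).
    split; [|left]; intros z Hz; apply E in Hz; destruct (He z Hz).
  - apply Ht. left. apply equ_refl.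
Qed.

Lemma level_power (v p : M) : level v -> is_power v p -> level p.
Proof.
  intros [t [Ht Hv]] Hp. destruct (pairing p p) as [s Hs].
  destruct (union2 t s) as [t' Ht']. exists t'. split.
  - intros x Hx. apply Ht' in Hx as [Hx|Hx].
    + destruct (Ht x Hx) as [K1 K2]. split; [exact K1|].
      destruct K2 as [K2|[w [Hw K2]]]; [left; exact K2|]. right. exists w.
      split; [apply Ht'; left; exact Hw | exact K2].
    + assert (E : ext_eq x p) by (apply copy_of_equ; apply Hs in Hx; tauto). split.
      * intros y Hy z Hz. apply E, Hp. apply E, Hp in Hy.
        exact (proj1 (Ht v Hv) z (Hy z Hz)).
      * right. exists v. split; [apply Ht'; left; exact Hv|].
        intros z. rewrite (E z). apply Hp.
  - apply Ht'. right. apply Hs. left. apply equ_refl.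
Qed.

(** Otherwise [v' ∈ v], and [n], a subset of [v'], would be an element of [v]. By symmetry
    [level_of] is functional up to copies, as Replacement requires. *)
Lemma level_of_sub (n v v' : M) : level_of n v -> level_of n v' -> sub v v'.
Proof.
  intros (Hv & _ & N) (Hv' & Hn & _).
  destruct (level_compare v v' Hv Hv') as [H|H]; [exact H|].
  destruct N. apply (level_sub_closed v v'); assumption.
Qed.

(** The successor raises the rank by one: members of [m] are subsets of [v], while [n ∈ m] and
    [n ∉ v] keep [m] from being a subset of [v]. *)
Lemma level_of_succ (n v m p : M) : level_of n v ->
  (forall y, y ∈ m <-> y ∈ n \/ equ y n) -> is_power v p -> level_of m p.
Proof.
  intros (Hv & Hn & N) Hm Hp. repeat split.
  - apply (level_power v); assumption.
  - intros y Hy. apply Hp. apply Hm in Hy as [Hy|Hy].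
    + apply level_trans; [assumption | apply Hn, Hy].
    + intros z Hz. apply Hn. apply copy_of_equ in Hy. apply Hy, Hz.
  - intros H. apply N. apply Hp in H. apply H, Hm. right. apply equ_refl.
Qed.

(* Infinity supplies [n ∪ {n}] with a single copy of [n], which is not saturated; the
   levels of the members of such a set nevertheless are all the finite levels. *)
Lemma saturated_infinity : exists W : M,
  (forall x, empty x -> x ∈ W) /\
  (forall x y, x ∈ W -> (forall z, z ∈ y -> z ∈ x \/ ext_eq z x) -> y ∈ W).
Proof.
  destruct infinity as [N [[e [He1 He2]] HN]].
  destruct (replacement_definable level_of N) as [C HC].
  { exists (fLevelOf 1 0). split; [simpl; repeat split; lia|]. intros r. sat_tac. }
  { intros n _ v v' Hv Hv' z. split; apply (level_of_sub n); assumption. }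
  destruct (union C) as [W HW].
  assert (E : forall n v z, n ∈ N -> level_of n v -> z ∈ v -> z ∈ W).
  { intros n v z Hn Hv Hz. apply HW. exists v. split; [|assumption].
    apply HC. exists n. split; [assumption|]. exists v. auto using ext_eq_refl. }
  exists W. split.
  (* The level of [e] is [e] itself and has no elements, so the level of the successor of [e] is
     used; it contains every empty set. *)
  - intros x Hx. destruct (HN e He1) as [m [Hm Em]]. destruct (power e) as [p Hp].
    apply (E m p); [assumption| |].
    + apply (level_of_succ e e); try assumption. repeat split.
      * apply level_empty, He2.
      * intros z Hz; exact Hz.
      * apply He2.
    + apply Hp. intros z Hz. destruct (Hx z Hz).
  - intros x y Hx Hy. apply HW in Hx as [v [Hv Hx]].
    apply HC in Hv as [n [Hn [v' [Hv' Ev]]]]. apply Ev in Hx.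
    destruct (HN n Hn) as [m [Hm Em]]. destruct (power v') as [p Hp].
    apply (E m p); [assumption | apply (level_of_succ n v'); assumption |].
    apply Hp. intros z Hz. destruct Hv' as [Lv _]. destruct (Hy z Hz) as [K|K].
    + apply (level_trans v' x); assumption.
    + apply (level_sub_closed v' x); try assumption. intros u Hu. apply K, Hu.
Qed.

Notation N := (hered_model M).

Lemma hered_model_intro (u : M) : saturated u -> (forall w, w ∈ u -> hered w) ->
  exists x : N, forall y : N, y ∈ x <-> proj1_sig y ∈ u.
Proof. intros H K. exists (exist _ u (hered_intro u H K)). reflexivity. Qed.

Lemma mem_val (x : M) (y : N) : x ∈ proj1_sig y -> exists x' : N, x' ∈ y /\ proj1_sig x' = x.
Proof.
  intros H. assert (Hx : hered x) by exact (hered_mem _ _ _ (proj2_sig y) H).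
  exists (exist _ x Hx). split; [exact H | reflexivity].
Qed.

Lemma val_ext_eq (x y : N) : ext_eq x y -> ext_eq (proj1_sig x) (proj1_sig y).
Proof.
  intros H z. split; intros Hz; apply mem_val in Hz as [z' [Hz <-]]; apply H, Hz.
Qed.

Lemma hered_pairing (A B : N) : exists X : N, forall y : N, y ∈ X <-> equ y A \/ equ y B.
Proof.
  destruct (copies (proj1_sig A)) as [a Ha]. destruct (copies (proj1_sig B)) as [b Hb].
  destruct (union2 a b) as [X HX].
  assert (E : forall y, y ∈ X <-> ext_eq y (proj1_sig A) \/ ext_eq y (proj1_sig B)).
  { intros y. rewrite HX, Ha, Hb. reflexivity. }
  destruct (hered_model_intro X) as [x Hx].
  - intros v Hv w Hw. apply E. apply E in Hv as [Hv|Hv]; [left|right];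
      exact (ext_eq_trans _ _ _ _ Hw Hv).
  - intros w Hw. apply E in Hw as [Hw|Hw]; (eapply hered_ext_eq; [|exact Hw]); apply proj2_sig.
  - exists x. intros y. rewrite Hx, E. reflexivity.
Qed.

Lemma hered_union (A : N) : exists X : N, forall y : N, y ∈ X <-> exists z : N, z ∈ A /\ y ∈ z.
Proof.
  destruct (union (proj1_sig A)) as [X HX].
  assert (E : forall y, y ∈ X <-> exists z : N, z ∈ A /\ y ∈ proj1_sig z).
  { intros y. rewrite HX. split.
    - intros [z [Hz Hy]]. apply mem_val in Hz as [z' [Hz <-]]. exists z'. auto.
    - intros [z [Hz Hy]]. exists (proj1_sig z). auto. }
  destruct (hered_model_intro X) as [x Hx].
  - intros v Hv w Hw. apply E in Hv as [z [Hz Hv]]. apply E. exists z.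
    split; [assumption|]. apply (hered_saturated _ _ (proj2_sig z) v); assumption.
  - intros w Hw. apply E in Hw as [z [_ Hw]]. exact (hered_mem _ _ _ (proj2_sig z) Hw).
  - exists x. intros y. rewrite Hx, E. reflexivity.
Qed.

Lemma hered_power (A : N) : exists X : N, is_power A X.
Proof.
  destruct (power (proj1_sig A)) as [P HP].
  destruct (separation saturated P) as [X HX].
  { exists (fSaturated 0). split; [simpl; repeat split; lia|]. intros r. sat_tac. }
  assert (E : forall y, y ∈ X <-> sub y (proj1_sig A) /\ saturated y).
  { intros y. rewrite HX. split.
    - intros [x (Hx & Sx & Ex)]. split; [|apply (saturated_ext_eq _ x); assumption].
      intros z Hz. apply HP in Hx. apply Hx, Ex, Hz.
    - intros [Hy Sy]. exists y. split; [apply HP, Hy|]. split; [exact Sy | apply ext_eq_refl]. }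
  destruct (hered_model_intro X) as [x Hx].
  - intros v Hv w Hw. apply E in Hv as [Hv Sv]. apply E.
    split; [|apply (saturated_ext_eq _ v); assumption].
    intros z Hz. apply Hv, Hw, Hz.
  - intros w Hw. apply E in Hw as [Hw Sw]. apply hered_intro; [assumption|].
    intros z Hz. apply (hered_mem _ z (proj1_sig A)); [apply proj2_sig | apply Hw, Hz].
  - exists x. intros y. rewrite Hx, E. split.
    + intros [Hy _] z Hz. apply Hy, Hz.
    + intros Hy. split; [|apply hered_saturated, proj2_sig].
      intros z Hz. apply mem_val in Hz as [z' [Hz <-]]. apply Hy, Hz.
Qed.

Lemma hered_foundation (A : N) : (exists x, x ∈ A) ->
  exists y, y ∈ A /\ ~ exists z, z ∈ A /\ z ∈ y.
Proof.
  intros [x Hx]. destruct (foundation (proj1_sig A)) as [y [Hy K]].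
  { exists (proj1_sig x). exact Hx. }
  apply mem_val in Hy as [y' [Hy <-]]. exists y'. split; [assumption|].
  intros [z [Hz Hzy]]. apply K. exists (proj1_sig z). auto.
Qed.

Lemma hered_infinity : exists I : N, (exists e, e ∈ I /\ empty e) /\
  forall n, n ∈ I -> exists m, m ∈ I /\ forall y, y ∈ m <-> y ∈ n \/ equ y n.
Proof.
  destruct saturated_infinity as [W [W0 WS]].
  destruct (separation hered W) as [I HI].
  { exists (fHered 0). split; [simpl; repeat split; lia|]. intros r. sat_tac. }
  destruct (hered_model_intro I) as [x Hx].
  { intros v Hv w Hw. apply HI in Hv as [u (Hu & Su & Eu)]. apply HI. exists u.
    repeat (split; [assumption|]). exact (ext_eq_trans _ _ _ _ Hw Eu). }
  { intros w Hw. apply HI in Hw as [u (_ & Su & Eu)]. exact (hered_ext_eq _ _ _ Su Eu). }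
  assert (E : forall y : N, proj1_sig y ∈ W -> y ∈ x).
  { intros y Hy. apply Hx, HI. exists (proj1_sig y).
    split; [assumption|]. split; [apply proj2_sig | apply ext_eq_refl]. }
  exists x. split.
  - destruct infinity as [_ [[e [_ He]] _]].
    destruct (hered_model_intro e) as [e' He'].
    { intros v Hv. destruct (He v Hv). }
    { intros v Hv. destruct (He v Hv). }
    exists e'. split.
    + apply E, W0. intros z Hz. apply mem_val in Hz as [z' [Hz _]]. apply He' in Hz.
      exact (He _ Hz).
    + intros z Hz. apply He' in Hz. exact (He _ Hz).
  - intros n Hn. apply Hx, HI in Hn as [u (Hu & Su & Eu)].
    destruct (copies (proj1_sig n)) as [c Hc].
    destruct (union2 (proj1_sig n) c) as [m Hm].
    destruct (hered_model_intro m) as [m' Hm'].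
    { intros v Hv w Hw. apply Hm. apply Hm in Hv as [Hv|Hv]; [left|right].
      - apply (hered_saturated _ _ (proj2_sig n) v); assumption.
      - apply Hc. apply Hc in Hv. exact (ext_eq_trans _ _ _ _ Hw Hv). }
    { intros w Hw. apply Hm in Hw as [Hw|Hw].
      - exact (hered_mem _ _ _ (proj2_sig n) Hw).
      - apply Hc in Hw. exact (hered_ext_eq _ _ _ (proj2_sig n) Hw). }
    assert (Em : forall y, y ∈ m' <-> y ∈ n \/ equ y n).
    { intros y. rewrite Hm', Hm, Hc. reflexivity. }
    exists m'. split; [|exact Em]. apply E, (WS u _ Hu).
    intros z Hz. apply mem_val in Hz as [z' [Hz <-]].
    apply Em in Hz as [Hz|Hz]; [left; apply Eu, Hz | right].
    exact (ext_eq_trans _ _ _ _ Hz Eu).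
Qed.

Lemma hered_replacement phi : bounded 2 phi -> forall (r : nat -> N) (A : N),
  (forall x, x ∈ A -> forall y y', sat N (cons_env y (cons_env x r)) phi ->
     sat N (cons_env y' (cons_env x r)) phi -> equ y y') ->
  exists B : N, forall y, y ∈ B <->
    exists x, x ∈ A /\ sat N (cons_env y (cons_env x r)) phi.
Proof.
  intros Hb r A HF.
  pose (F := fun x y => hered y /\
    sat M (cons_env y (cons_env x r0)) (translate hered_translation phi)).
  assert (Hb' : bounded 2 (translate hered_translation phi)) by (apply bounded_translate, Hb).
  assert (EF : forall x y : N, F (proj1_sig x) (proj1_sig y) <->
                 sat N (cons_env y (cons_env x r)) phi).
  { intros x y. rewrite sat_translate. unfold F.
    rewrite (sat_bounded M _ 2 _ (fun i => proj1_sig (cons_env y (cons_env x r) i)) Hb').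
    - pose proof (proj2_sig y). tauto.
    - intros [|[|i]] Hi; [reflexivity|reflexivity|lia]. }
  destruct (replacement_definable F (proj1_sig A)) as [B HB].
  - exists (fHered 0 ∧ translate hered_translation phi)%fo.
    split; [simpl; repeat split; auto; lia|].
    intros r'. unfold F. apply sat_and; [exact (sat_fHered _ _ _)|].
    apply (sat_bounded M _ 2); [assumption|].
    intros [|[|i]] Hi; [reflexivity|reflexivity|lia].
  - intros x Hx y y' Hy Hy'. apply mem_val in Hx as [x' [Hx <-]].
    pose (z := exist _ y (proj1 Hy) : N). pose (z' := exist _ y' (proj1 Hy') : N).
    apply (HF x' Hx z z'); apply EF; assumption.
  - assert (E : forall y, y ∈ B <-> exists x y' : N, x ∈ A /\
       sat N (cons_env y' (cons_env x r)) phi /\ ext_eq y (proj1_sig y')).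
    { intros y. rewrite HB. split.
      - intros [x [Hx [y' [Hy' Ey]]]]. apply mem_val in Hx as [x' [Hx <-]].
        exists x', (exist _ y' (proj1 Hy')). split; [assumption|].
        split; [apply EF; assumption | assumption].
      - intros [x [y' (Hx & Hy' & Ey)]]. exists (proj1_sig x). split; [assumption|].
        exists (proj1_sig y'). split; [apply EF, Hy' | exact Ey]. }
    destruct (hered_model_intro B) as [b Hbm].
    + intros v Hv w Hw. apply E in Hv as [x [y (Hx & Hy & Ey)]]. apply E. exists x, y.
      repeat (split; [assumption|]). exact (ext_eq_trans _ _ _ _ Hw Ey).
    + intros w Hw. apply E in Hw as [x [y (_ & _ & Ey)]].
      exact (hered_ext_eq _ _ _ (proj2_sig y) Ey).
    + exists b. intros y. rewrite Hbm, E. split.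
      * intros [x [y' (Hx & Hy & Ey)]]. exists x. split; [assumption|].
        refine (proj1 (sat_equ N phi 2 _ _ Hb _) Hy).
        intros [|[|i]] Hi; [exact (ext_eq_sym _ _ _ Ey) | apply equ_refl | lia].
      * intros [x [Hx Hy]]. exists x, y. auto using ext_eq_refl.
Qed.

End SetTheory.

Lemma sat_replacement (S : model) (r : nat -> S) phi :
  sat S r (replacement phi) <-> forall A,
    (forall x, mem x A -> forall y y', sat S (cons_env y (cons_env x r)) phi /\
       sat S (cons_env y' (cons_env x r)) phi -> equ y y') ->
    exists B, forall y, mem y B <->
      exists x, mem x A /\ sat S (cons_env y (cons_env x r)) phi.
Proof.
  unfold replacement, at_xy. sat_tac; apply sat_ext; intros [|[|i]]; reflexivity.
Qed.

Lemma sat_alls (S : model) n p : (forall r : nat -> S, sat S r p) ->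
  forall r : nat -> S, sat S r (alls n p).
Proof. intros H. induction n; simpl; auto. Qed.

(** * Elimination of parameters *)

Definition fSingleton x s := All (0 ∈ S s ⟷ 0 ≐ S x)%fo.
(* The pair [(x, p)] is coded by [{{{x}}, {∅, {p}}}]: as the two tags never coincide, the
   pairs with first component in [A] can be recognized without [p] among the subsets of
   [{{{x}} | x ∈ A} ∪ {{∅, {p}}}]. *)
Definition fTagElem x a := All (0 ∈ S a ⟷ fSingleton (S x) 0)%fo.
Definition fTagParam p b := All (0 ∈ S b ⟷ fEmpty 0 ∨ fSingleton (S p) 0)%fo.
Definition fCode c x p :=
  Ex (Ex (fTagElem (2 + x) 1 ∧ fTagParam (2 + p) 0 ∧
          All (0 ∈ 3 + c ⟷ 0 ≐ 2 ∨ 0 ≐ 1)))%fo.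

(** Variable [1] now codes the pair of the former variable [1] and the first parameter. *)
Definition fold_param phi :=
  Ex (Ex (fCode 3 1 0 ∧
    ren (scons 2 (scons 1 (scons 0 (fun i => 4 + i)))) phi))%fo.

Section FullReplacement.

Variable U : model.
Local Open Scope model_scope.

Hypothesis extensionality : forall x y : U, ext_eq x y -> equ x y.
Hypothesis pairing_ax : forall A B : U, exists X, forall y, y ∈ X <-> equ y A \/ equ y B.
Hypothesis union_ax : forall A : U, exists X, forall y, y ∈ X <-> exists z, z ∈ A /\ y ∈ z.
Hypothesis power_ax : forall A : U, exists X, is_power A X.
Hypothesis empty_ax : exists e : U, empty e.
Hypothesis replacement_ax : forall phi, bounded 2 phi ->
  forall r : nat -> U, sat U r (replacement phi).

Definition singleton (x s : U) : Prop := forall z, z ∈ s <-> equ z x.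
Definition tag_elem (x a : U) : Prop := forall z, z ∈ a <-> singleton x z.
Definition tag_param (p b : U) : Prop := forall z, z ∈ b <-> empty z \/ singleton p z.
Definition pair_code (c x p : U) : Prop := exists a b,
  tag_elem x a /\ tag_param p b /\ forall z, z ∈ c <-> equ z a \/ equ z b.

Lemma sat_fSingleton (r : nat -> U) x s : sat U r (fSingleton x s) <-> singleton (r x) (r s).
Proof. unfold fSingleton, singleton. sat_tac. Qed.

Hint Extern 0 (sat _ _ (fSingleton _ _) <-> _) => exact (sat_fSingleton _ _ _) : sat.

Lemma sat_fTagElem (r : nat -> U) x a : sat U r (fTagElem x a) <-> tag_elem (r x) (r a).
Proof. unfold fTagElem, tag_elem. sat_tac. Qed.

Lemma sat_fTagParam (r : nat -> U) x a : sat U r (fTagParam x a) <-> tag_param (r x) (r a).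
Proof. unfold fTagParam, tag_param. sat_tac. Qed.

Hint Extern 0 (sat _ _ (fTagElem _ _) <-> _) => exact (sat_fTagElem _ _ _) : sat.
Hint Extern 0 (sat _ _ (fTagParam _ _) <-> _) => exact (sat_fTagParam _ _ _) : sat.

Lemma sat_fCode (r : nat -> U) c x p :
  sat U r (fCode c x p) <-> pair_code (r c) (r x) (r p).
Proof. unfold fCode, pair_code. sat_tac. Qed.

Hint Extern 0 (sat _ _ (fCode _ _ _) <-> _) => exact (sat_fCode _ _ _ _) : sat.

Lemma equ_mem (x y z : U) : equ x y -> z ∈ x -> z ∈ y.
Proof. apply mem_equ, equ_refl. Qed.

Lemma equ_elem (x y z : U) : equ x y -> x ∈ z -> y ∈ z.
Proof. intros H. apply mem_equ; [exact H | apply equ_refl]. Qed.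

Lemma singleton_exists (x : U) : exists s, singleton x s.
Proof. destruct (pairing_ax x x) as [s Hs]. exists s. intros z. rewrite Hs. tauto. Qed.

Lemma singleton_inj (x y s : U) : singleton x s -> singleton y s -> equ x y.
Proof. intros H K. apply K, H, equ_refl. Qed.

Lemma singleton_unique (x s s' : U) : singleton x s -> singleton x s' -> equ s s'.
Proof. intros H K. apply extensionality. intros z. rewrite (H z), (K z). reflexivity. Qed.

Lemma singleton_equ (x s s' : U) : singleton x s -> equ s s' -> singleton x s'.
Proof.
  intros H E z. rewrite <- (H z). split; apply equ_mem; auto using equ_sym.
Qed.

Lemma singleton_not_empty (x s : U) : singleton x s -> ~ empty s.
Proof. intros H K. apply (K x), H, equ_refl. Qed.

Lemma tag_elem_exists (x : U) : exists a, tag_elem x a.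
Proof.
  destruct (singleton_exists x) as [s Hs]. destruct (singleton_exists s) as [a Ha].
  exists a. intros z. rewrite (Ha z). split; intros H.
  - apply (singleton_equ _ s); auto using equ_sym.
  - apply (singleton_unique x); assumption.
Qed.

Lemma tag_param_exists (x : U) : exists a, tag_param x a.
Proof.
  destruct (singleton_exists x) as [s Hs]. destruct empty_ax as [e He].
  destruct (pairing_ax e s) as [a Ha].
  exists a. intros z. rewrite (Ha z). split; (intros [H|H]; [left|right]).
  - intros y Hy. apply (He y), (equ_mem z); assumption.
  - apply (singleton_equ _ s); auto using equ_sym.
  - apply extensionality. intros y. split; intros Hy; [destruct (H y Hy) | destruct (He y Hy)].
  - apply (singleton_unique x); assumption.
Qed.

Lemma tag_elem_unique (x a a' : U) : tag_elem x a -> tag_elem x a' -> equ a a'.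
Proof. intros H K. apply extensionality. intros z. rewrite (H z), (K z). reflexivity. Qed.

Lemma tag_elem_inj (x y a b : U) : tag_elem x a -> tag_elem y b -> equ a b -> equ x y.
Proof.
  intros Ha Hb E. destruct (singleton_exists x) as [s Hs].
  apply (singleton_inj _ _ s); [assumption|]. apply Hb, (equ_mem a), Ha; assumption.
Qed.

Lemma tag_param_inj (x y a b : U) : tag_param x a -> tag_param y b -> equ a b -> equ x y.
Proof.
  intros Ha Hb E. destruct (singleton_exists x) as [s Hs].
  apply (singleton_inj _ _ s); [assumption|].
  destruct (proj1 (Hb s)) as [K|K]; [|destruct (singleton_not_empty x s Hs K)|exact K].
  apply (equ_mem a b s E), Ha. right; assumption.
Qed.

Lemma tag_disjoint (x p a b : U) : tag_elem x a -> tag_param p b -> ~ equ a b.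
Proof.
  intros Ha Hb E. destruct empty_ax as [e He]. apply (singleton_not_empty x e); [|exact He].
  apply Ha, (equ_mem b); [apply equ_sym, E|]. apply Hb. left; exact He.
Qed.

Lemma pair_code_inj (c x p y q : U) : pair_code c x p -> pair_code c y q -> equ x y.
Proof.
  intros (a & b & Ha & Hb & Hc) (a' & b' & Ha' & Hb' & Hc').
  assert (K : a ∈ c) by (apply Hc; left; apply equ_refl).
  apply Hc' in K as [K|K]; [apply (tag_elem_inj x y a a'); assumption|].
  destruct (tag_disjoint x q a b' Ha Hb' K).
Qed.

Lemma pair_codes_exist (A p : U) : exists D,
  (forall c x q, c ∈ D -> pair_code c x q -> x ∈ A /\ equ q p) /\
  (forall x, x ∈ A -> exists c, c ∈ D /\ pair_code c x p).
Proof.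
  assert (H1 : exists A1, forall a, a ∈ A1 <-> exists x, x ∈ A /\ tag_elem x a).
  { assert (Hb : bounded 2 (fTagElem 1 0)) by (simpl; repeat split; lia).
    assert (K := replacement_ax _ Hb (fun _ => A)). rewrite sat_replacement in K.
    destruct (K A) as [A1 HA1].
    - intros x _ y y' [Hy Hy']. apply sat_fTagElem in Hy, Hy'.
      apply (tag_elem_unique x); assumption.
    - exists A1. intros a. rewrite HA1. split; intros [x [Hx Ha]]; exists x;
        (split; [assumption|]); apply sat_fTagElem in Ha || apply sat_fTagElem; exact Ha. }
  destruct H1 as [A1 HA1]. destruct (tag_param_exists p) as [b Hb].
  destruct (singleton_exists b) as [B HB]. destruct (pairing_ax A1 B) as [V HV].
  destruct (union_ax V) as [W HW]. destruct (power_ax W) as [D HD].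
  assert (E : forall z, z ∈ W <-> z ∈ A1 \/ equ z b).
  { intros z. rewrite HW, <- (HB z). split.
    - intros [y [Hy Hz]]. apply HV in Hy as [Hy|Hy]; [left|right];
        apply (equ_mem y); assumption.
    - intros [Hz|Hz]; eexists; (split; [|exact Hz]); apply HV; [left|right]; apply equ_refl. }
  exists D. split.
  - intros c x q Hc (a' & b' & Ha' & Hb' & Hcab). split.
    + assert (K : a' ∈ W) by (apply HD in Hc; apply Hc, Hcab; left; apply equ_refl).
      apply E in K as [K|K]; [|destruct (tag_disjoint x p a' b Ha' Hb K)].
      apply HA1 in K as [y [Hy Hay]]. apply (equ_elem y); [|assumption].
      apply (tag_elem_inj y x a' a'); auto using equ_refl.
    + assert (K : b' ∈ W) by (apply HD in Hc; apply Hc, Hcab; right; apply equ_refl).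
      apply E in K as [K|K]; [|apply (tag_param_inj q p b' b); assumption].
      apply HA1 in K as [y [Hy Hay]]. destruct (tag_disjoint y q b' b' Hay Hb' (equ_refl _ _)).
  - intros x Hx. destruct (tag_elem_exists x) as [a Ha]. destruct (pairing_ax a b) as [c Hc].
    exists c. split; [|exists a, b; auto]. apply HD. intros z Hz. apply E.
    apply Hc in Hz as [Hz|Hz]; [left|right; exact Hz]. apply HA1.
    exists x. split; [assumption|]. intros y. rewrite <- (Ha y).
    split; apply equ_mem; auto using equ_sym.
Qed.

Lemma sat_fold_param (r : nat -> U) phi y c :
  sat U (cons_env y (cons_env c (fun i => r (S i)))) (fold_param phi) <->
  exists x q, pair_code c x q /\
    sat U (cons_env y (cons_env x (cons_env q (fun i => r (S i))))) phi.
Proof.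
  unfold fold_param. sat_tac. apply sat_ext. intros [|[|[|i]]]; reflexivity.
Qed.

Lemma replacement_with_parameters n : forall phi, bounded (2 + n) phi ->
  forall r : nat -> U, sat U r (replacement phi).
Proof.
  induction n as [|n IH]; intros phi Hb r; [apply replacement_ax, Hb|].
  apply sat_replacement. intros A HF.
  assert (Hb' : bounded (2 + n) (fold_param phi)).
  { split; [|exact I]. split; [|exact I]. split; [|exact I]. split; [|exact I].
    split; [|exact I]. split; [simpl; repeat split; lia|]. split; [|exact I].
    apply (bounded_ren _ (2 + S n)); [assumption|].
    intros [|[|[|i]]] Hi; simpl; lia. }
  assert (K := IH _ Hb' (fun i => r (S i))). rewrite sat_replacement in K.
  assert (Hr : forall y x x' q, equ x' x -> equ q (r 0) ->
    sat U (cons_env y (cons_env x' (cons_env q (fun i => r (S i))))) phi <->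
    sat U (cons_env y (cons_env x r)) phi).
  { intros y x x' q Hx Hq. apply (sat_equ U _ (2 + S n)); [assumption|].
    intros [|[|[|i]]] _; simpl; auto using equ_refl. }
  destruct (pair_codes_exist A (r 0)) as [D [HD1 HD2]].
  destruct (K D) as [B HB].
  - intros c Hc y y' [Hy Hy']. apply sat_fold_param in Hy as (x & q & Hx & Hy).
    apply sat_fold_param in Hy' as (x' & q' & Hx' & Hy').
    destruct (HD1 c x q Hc Hx) as [HxA Hq]. destruct (HD1 c x' q' Hc Hx') as [_ Hq'].
    apply (HF x HxA). split.
    + apply (Hr y x x q); auto using equ_refl.
    + apply (Hr y' x x' q'); auto. apply (pair_code_inj c x' q' x q); assumption.
  - exists B. intros y. rewrite HB. split.
    + intros [c [Hc Hy]]. apply sat_fold_param in Hy as (x & q & Hx & Hy).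
      destruct (HD1 c x q Hc Hx) as [HxA Hq]. exists x. split; [assumption|].
      apply (Hr y x x q); auto using equ_refl.
    + intros [x [Hx Hy]]. destruct (HD2 x Hx) as [c [Hc Hcx]]. exists c.
      split; [assumption|]. apply sat_fold_param. exists x, (r 0).
      split; [assumption|]. apply (Hr y x x (r 0)); auto using equ_refl.
Qed.

End FullReplacement.

Lemma hered_model_ZF (M : model) (r0 : nat -> M) :
  (forall q, ZFstar_minus_Ext q -> sat M r0 q) ->
  forall q, ZF q -> forall r : nat -> hered_model M, sat (hered_model M) r q.
Proof.
  intros HM.
  assert (Hext : forall x y : hered_model M, ext_eq x y -> equ x y) by (apply val_ext_eq).
  intros q [ | | | | | |n phi Hphi] r.
  - apply (sat_all _ _ _ (fun x => forall y, ext_eq x y -> equ x y)); [|exact Hext].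
    unfold ext_eq. sat_tac.
  - refine (proj2 (_ : sat _ r _ <-> _) (hered_foundation M r0 HM)).
    unfold ax_foundation. sat_tac.
  - refine (proj2 (_ : sat _ r _ <-> _) (hered_pairing M r0 HM)).
    unfold ax_pairing. sat_tac.
  - refine (proj2 (_ : sat _ r _ <-> _) (hered_union M r0 HM)).
    unfold ax_union. sat_tac.
  - refine (proj2 (_ : sat _ r _ <-> _) (hered_power M r0 HM)).
    unfold ax_power, is_power, sub. sat_tac.
  - refine (proj2 (_ : sat _ r _ <-> _) (hered_infinity M r0 HM)).
    unfold ax_infinity, empty. sat_tac.
  - apply sat_alls. apply (replacement_with_parameters _ Hext) with (n := n).
    + apply (hered_pairing M r0 HM).
    + apply (hered_union M r0 HM).
    + apply (hered_power M r0 HM).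
    + destruct (hered_infinity M r0 HM) as [_ [[e [_ He]] _]]. exists e; exact He.
    + intros psi Hpsi r'. apply sat_replacement. intros A HF.
      apply (hered_replacement M r0 HM psi Hpsi r' A).
      intros x Hx y y' Hy Hy'. apply (HF x Hx). auto.
    + exact Hphi.
Qed.

Lemma ZFstar_minus_Ext_closed q : ZFstar_minus_Ext q -> sentence q.
Proof.
  intros [ | | | | |phi Hphi]; unfold sentence; simpl; repeat split; try lia;
    (apply (bounded_mono phi 2); [lia | assumption]).
Qed.

Theorem mainTheorem1 : interprets ZFstar_minus_Ext ZF.
Proof.
  exists hered_translation. intros p Hp [G [HG Hprv]].
  apply completeness; [apply ZFstar_minus_Ext_closed|].
  intros M r HM. destruct (hered_infinity M r HM) as [w _].
  rewrite (sat_bounded M _ 0 r (fun _ => proj1_sig w)).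
  - apply (sat_translate M p (fun _ => w)), (soundness G p Hprv).
    intros q Hq. apply (hered_model_ZF M r HM); auto.
  - apply bounded_translate, Hp.
  - intros i Hi. lia.
Qed.
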